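(* Let $(P,\le,0,1)$ be a complemented poset of finite length and $a,b,c\in P$. Then the following hold: (i) If $\hookrightarrow$ is weakly antitone from the left then $a\circ b\le c$ implies $a\le b\to c$. (ii) If $\odot$ is weakly monotone from the right then $a\le b\to c$ implies $a\circ b\le c$.
   Context: $(P,\le,0,1)$ is a bounded poset with $0\ne1$, complemented (every element has a complement $b$ with $a\vee b=1$, $a\wedge b=0$), of finite length (no infinite chains). $x^+$ denotes the set of all complements of $x$. $\mathrm{Max}\,A$, $\mathrm{Min}\,A$ are the sets of maximal, minimal elements of $A$; $L(A)$, $U(A)$ the sets of lower, upper bounds, with $L(A,B):=L(A\cup B)$ etc. Define $a\circ b:=\mathrm{Max}\,L(a,b)$, $a\to b:=\mathrm{Min}\,U(a^+,b)$, $a\odot b:=\mathrm{Max}\,L\big(b,U(a,b^+)\big)$, $a\hookrightarrow b:=\mathrm{Min}\,U\big(a^+,L(a,b)\big)$. For sets, $A\le B$ means $x\le y$ for all $x\in A$, $y\in B$ (singletons identified with elements). $\hookrightarrow$ is weakly antitone from the left if $x\hookrightarrow y\ge1\hookrightarrow y$ for all $x,y$; $\odot$ is weakly monotone from the right if $x\odot y\le x\odot1$ for all $x,y$. *)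

(* Defs.v *)
From mathcomp Require Import all_boot all_order.
From mathcomp Require Import boolp classical_sets cardinality.
Set Implicit Arguments.
Unset Strict Implicit.
Unset Printing Implicit Defensive.

Local Open Scope order_scope.
Local Open Scope classical_set_scope.

Section Poset.
Context {d : Order.disp_t} {P : tbPOrderType d}.
Implicit Types (a b x y : P) (A B : set P).

Definition maxima A : set P := [set x | A x /\ forall y, A y -> x <= y -> y = x].
Definition minima A : set P := [set x | A x /\ forall y, A y -> y <= x -> y = x].

(* [a \/ b = 1] in a poset means that the supremum of a and b exists and is 1;
   dually for [a /\ b = 0]. *)
Definition complements a : set P :=
  [set b | supremums [set a; b] \top /\ infimums [set a; b] \bot].

Definition le_set A B : Prop := forall x y, A x -> B y -> x <= y.

(* The operators a o b, a -> b, a (.) b and a ~> b (hooked arrow) are set-valued: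
   the relevant meets and joins need not exist in P. *)
Definition circ a b : set P := maxima (lbound [set a; b]).
Definition arrow a b : set P := minima (ubound (complements a `|` [set b])).
Definition odot a b : set P :=
  maxima (lbound ([set b] `|` ubound ([set a] `|` complements b))).
Definition hookarrow a b : set P :=
  minima (ubound (complements a `|` lbound [set a; b])).

End Poset.

Definition complemented {d : Order.disp_t} (P : tbPOrderType d) : Prop :=
  forall a : P, exists b, complements a b.

Definition finite_length {d : Order.disp_t} (P : tbPOrderType d) : Prop :=
  forall C : set P, total_on C (fun x y => x <= y) -> finite_set C.

Definition hookarrow_weakly_antitone_left {d : Order.disp_t}
    (P : tbPOrderType d) : Prop :=
  forall x y : P, le_set (hookarrow \top y) (hookarrow x y).

Definition odot_weakly_monotone_right {d : Order.disp_t}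
    (P : tbPOrderType d) : Prop :=
  forall x y : P, le_set (odot x y) (odot x \top).

(* Main.v *)
(* By finite length, every element of a set lies below a maximal and above a
   minimal element of it, so the bounds by [a o b] and [b -> c] extend to
   [L(a,b)] and [U(b^+,c)].  As [1 ~> a = {a}] and [c (.) 1 = {c}], weak
   antitonicity at [b ~> a] gives (i), and weak monotonicity at [c (.) b]
   gives (ii). *)
Require Import Defs.
From mathcomp Require Import all_boot all_order.
From mathcomp Require Import boolp classical_sets cardinality.

Local Open Scope order_scope.
Local Open Scope classical_set_scope.

Import Order.TTheory.

(** If no maximal element of [A] lay above [x], choice would build a strictly increasing sequence in
    [A] starting at [x], whose range is an infinite chain. *)
Lemma exists_maximal_above {d : Order.disp_t} {P : tbPOrderType d}
    {A : set P} {x : P} :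
  finite_length P -> A x -> exists2 y, maxima A y & x <= y.
Proof.
move=> fl Ax; apply: contrapT => nomax.
pose S := [set y | A y /\ x <= y].
(* The implication sits under the existential so that [choice] yields a total [f]; outside [S] the
   witness [y] is a dummy. *)
have step y : exists z, S y -> S z /\ y < z.
  have [[Ay xy]|nS] := pselect (S y); last by exists y.
  apply: contrapT => noz; apply: nomax; exists y => //; split=> // z Az yz.
  apply/eqP/negPn/negP => zy; apply: noz; exists z => _.
  by rewrite lt_neqAle eq_sym zy yz; split=> //; split=> //; apply: le_trans yz.
have [f fP] := choice step.
pose u n := iter n f x.
have Su n : S (u n) by elim: n => [|n /fP []].
have u_lt : {homo u : m n / (m < n)%N >-> m < n}.
  by apply: homo_ltn => [? ? ?|n]; [exact: lt_trans|have [] := fP _ (Su n)].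
have u_inj : injective u.
  move=> m n umn; have [/u_lt|/u_lt|//] := ltngtP m n; by rewrite umn ltxx.
have : finite_set (range u).
  apply: fl => _ _ [m _ <-] [n _ <-].
  have [/u_lt/ltW|/u_lt/ltW|->] := ltngtP m n; [by left|by right|by left].
rewrite (eq_finite_set (inj_card_eq (in2W u_inj))).
exact: infinite_nat.
Qed.

(** Order dual of the previous lemma: [P] and [P^d] have the same chains. *)
Lemma exists_minimal_below {d : Order.disp_t} {P : tbPOrderType d}
    {A : set P} {x : P} :
  finite_length P -> A x -> exists2 y, minima A y & y <= x.
Proof.
move=> fl; apply: (@exists_maximal_above _ P^d) => C totC.
by apply: fl => y z Cy Cz; case: (totC y z Cy Cz); [right|left].
Qed.

Lemma complements_top (d : Order.disp_t) (P : tbPOrderType d) :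
  complements (\top : P) = [set \bot].
Proof.
apply/seteqP; split=> [b [_ [_ lb]]|_ ->].
  apply/le_anti; rewrite le0x andbT; apply: lb => _ [->|->] //; exact: lex1.
split; split=> [_ [->|->]|y yb]; rewrite ?lex1 ?le0x //.
- by apply: yb; left.
- by apply: yb; right.
Qed.

(** Since $1^+ = \{0\}$ and $L(1,a)$ is the principal ideal of [a], the upper bounds in question are
    exactly the elements above [a]. *)
Lemma hookarrow_top (d : Order.disp_t) (P : tbPOrderType d) (a : P) :
  hookarrow \top a a.
Proof.
rewrite /hookarrow complements_top; split=> [y [->|lby]|y uby ya].
- exact: le0x.
- by apply: lby; right.
apply/le_anti; rewrite ya; apply: uby; right=> _ [->|->] //; exact: lex1.
Qed.

(** Here $U(c,0)$ is the principal filter of [c], whose lower bounds are the elements below [c]. *)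
Lemma odot_top (d : Order.disp_t) (P : tbPOrderType d) (c : P) :
  odot c \top c.
Proof.
rewrite /odot complements_top; split=> [y [->|uby]|y lby cy].
- exact: lex1.
- by apply: uby; left.
apply/le_anti; rewrite cy andbT; apply: lby; right=> _ [->|->] //; exact: le0x.
Qed.

Theorem theorem4p5 (d : Order.disp_t) (P : tbPOrderType d)
    (P_nontrivial : (\bot : P) <> \top)
    (P_complemented : complemented P)
    (P_finite_length : finite_length P)
    (a b c : P) :
  (hookarrow_weakly_antitone_left P ->
     le_set (circ a b) [set c] -> le_set [set a] (arrow b c)) /\
  (odot_weakly_monotone_right P ->
     le_set [set a] (arrow b c) -> le_set (circ a b) [set c]).
Proof.
split=> [anti abc _ x -> [ubx _]|mono abc z _ [lbz _] ->].
  have ub_x : ubound (complements b `|` lbound [set b; a]) x.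
    move=> y [by_|]; first by apply: ubx; left.
    rewrite setUC => /(exists_maximal_above P_finite_length) [m mab ym].
    apply: le_trans ym (le_trans (abc m c mab erefl) _).
    by apply: ubx; right.
  (* [x] may fail to be minimal among these bounds, so antitonicity is applied to some [y] of
     [hookarrow b a] below it: $a \le y \le x$. *)
  have [y bay yx] := exists_minimal_below P_finite_length ub_x.
  exact: le_trans (anti b a _ _ (hookarrow_top _ _ _) bay) yx.
have lb_z : lbound ([set b] `|` ubound ([set c] `|` complements b)) z.
  move=> y [->|]; first by apply: lbz; right.
  rewrite setUC => /(exists_minimal_below P_finite_length) [m mbc my].
  apply: le_trans (le_trans (abc a m erefl mbc) my).
  by apply: lbz; left.
(* Dually, [z] is raised to some [y] in [odot c b], and $z \le y \le c$. *)
have [y cby zy] := exists_maximal_above P_finite_length lb_z.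
exact: le_trans zy (mono c b _ _ cby (odot_top _ _ _)).
Qed.
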